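(* Let $\mathbf{G}(\lambda)$ be a real-rational (possibly improper) scalar transfer function, given by a minimal centred realisation $(A,B,C,D,E)_{\lambda_0}$ of order $n=\delta(\mathbf{G})$, where $\lambda_0\in\mathbb{R}$ is not a pole of $\mathbf{G}(\lambda)$. Let $\nu$ be a positive integer with $\nu<n$, let $\alpha>0$, $n_1,\dots,n_\alpha>0$ and $\beta\ge0$ be integers with $\sum_{i=1}^{\alpha}n_i=\nu$ and $\beta\le\nu$, and let $\mu_1,\dots,\mu_\alpha,p_1,\dots,p_\beta\in\overline{\mathbb{C}}\setminus\{\lambda_0\}$ be (pairwise) distinct points with $\mu_i\notin\Lambda(A-\lambda E)$ for all $i$. Assume that there exist $i\in\{1,\dots,\alpha\}$ and $j\in\{0,\dots,n_i-1\}$ such that $\eta_{\mathbf{G},j}(\mu_i)\neq0$. Let $S\in\mathbb{R}^{\nu\times\nu}$ be similar to $\mathrm{Jord}(\mathfrak{f}(\mu_1),n_1,\dots,\mathfrak{f}(\mu_\alpha),n_\alpha)$, let $L\in\mathbb{R}^{1\times\nu}$ be such that $(L,S)$ is observable, and let $\Pi\in\mathbb{R}^{n\times\nu}$ be the unique solution of $E\Pi+BL=(A-\lambda_0E)\Pi S$. Define $D_k:=\mathfrak{f}(p_k)I_\nu-S$ for $k\in\{1,\dots,\beta\}$. Then each $D_k$ is nonsingular. Moreover, setting $\mathcal{R}_k:=\mathrm{Re}(D_k^{-1})$ and $\mathcal{I}_k:=\mathrm{Im}(D_k^{-1})$ (entrywise real and imaginary parts), if $G\in\mathbb{R}^\nu$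 satisfies $\mathfrak{f}(\mu_i)\notin\Lambda(S-GL-\lambda I_\nu)$ for all $i\in\{1,\dots,\alpha\}$ and $$\begin{bmatrix}1\\0\end{bmatrix}+\begin{bmatrix}L\mathcal{R}_k\\L\mathcal{I}_k\end{bmatrix}G=\begin{bmatrix}0\\0\end{bmatrix}\quad\text{for all }k\in\{1,\dots,\beta\},$$ then the centred realisation $$(A_m,B_m,C_m,D_m,E_m)_{\lambda_0}:=\big(I_\nu+\lambda_0(S-GL),\;G,\;C\Pi,\;D,\;S-GL\big)_{\lambda_0},$$ of the transfer function $\mathbf{H}(\lambda)=C_m(\lambda E_m-A_m)^{-1}B_m(\lambda_0-\lambda)+D_m$, satisfies both $$\eta_{\mathbf{G},j}(\mu_i)=\eta_{\mathbf{H},j}(\mu_i)\quad\text{for all } i\in\{1,\dots,\alpha\},\ j\in\{0,\dots,n_i-1\}$$ and $$p_k\in\Lambda(A_m-\lambda E_m)\quad\text{for all }k\in\{1,\dots,\beta\}.$$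
   Context: $\overline{\mathbb{C}}:=\mathbb{C}\cup\{\infty\}$. A transfer function is a real-rational function of the complex indeterminate $\lambda$. If $\mathbf{G}=b/a$ with $a,b$ coprime real polynomials, its McMillan degree is $\delta(\mathbf{G}):=\max\{\deg a,\deg b\}$; its finite poles are the roots of $a$, and $\infty$ is a pole of $\mathbf{G}(\lambda)$ if $0$ is a pole of $\mathbf{G}(1/\lambda)$. Centred realisations: for $\lambda_0\in\mathbb{C}$, a realisation of order $n$ centred at $\lambda_0$ of $\mathbf{G}(\lambda)$, denoted $(A,B,C,D,E)_{\lambda_0}$, consists of real matrices $A,E\in\mathbb{R}^{n\times n}$, $B,C^\top\in\mathbb{R}^n$, $D\in\mathbb{R}$ with $\det(A-\lambda E)\not\equiv0$ and $\mathbf{G}(\lambda)=C(\lambda E-A)^{-1}B(\lambda_0-\lambda)+D$. (For $\lambda_0=\infty$: $\mathbf{G}(\lambda)=C(\lambda E-A)^{-1}B+D$.) A centred realisation is minimal if its order is no greater than that of any other centred realisation of the same transfer function, regardless of centring points; equivalently, if its order equals $\delta(\mathbf{G})$. For matrices $M,N$ of the same size, $\Lambda(M-\lambda N)\subseteq\overline{\mathbb{C}}$ denotes the set of generalised eigenvalues of the pencil; for a square pencil with $\det(M-\lambda N)\not\equiv0$ these are the finite roots of $\det(M-\lambda N)$, together with $\infty$ if $\det N=0$. Möbius map: $\mathfrak{f}:\overline{\mathbb{C}}\to\overline{\mathbb{C}}$, $\mathfrak{f}(\lambda):=\frac{1}{\lambda-\lambda_0}$, with $\mathfrak{f}(\infty)=0$,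 $\mathfrak{f}(\lambda_0)=\infty$. $\mathrm{Jord}(\theta_1,n_1,\dots,\theta_q,n_q)$ denotes the block-diagonal matrix in Jordan canonical form whose Jordan block associated with $\theta_i\in\mathbb{C}$ is of size $n_i\times n_i$. Similarity is over $\mathbb{C}$. A pair $(L,S)$ with $L\in\mathbb{R}^{1\times\nu}$, $S\in\mathbb{R}^{\nu\times\nu}$ is observable if $\mathrm{rank}\begin{bmatrix}L^\top & S^\top L^\top&\cdots&(S^\top)^{\nu-1}L^\top\end{bmatrix}=\nu$. In the stated setting the equation $E\Pi+BL=(A-\lambda_0E)\Pi S$ has a unique solution $\Pi\in\mathbb{R}^{n\times\nu}$. Moments: for $\mu\in\overline{\mathbb{C}}$ not a pole of $\mathbf{G}(\lambda)$, the $i$-th order moment of $\mathbf{G}$ at $\mu$ is $\eta_{\mathbf{G},i}(\mu):=\frac{(-1)^i}{i!}\mathbf{G}^{(i)}(\mu)$, where $\mathbf{G}^{(i)}$ is the $i$-th derivative with respect to $\lambda$; at $\mu=\infty$ the value is understood as the limit for $\lambda\to\infty$. *)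

(* Defs.v *)
(* MathComp, with R[i] from real-closed and limits and derivatives from
   MathComp-Analysis. *)
From HB Require Import structures.
From mathcomp Require Import all_boot all_order all_algebra.
From mathcomp Require Import complex.
From mathcomp Require Import all_classical all_reals.
From mathcomp Require Import topology normedtype derive.

Set Implicit Arguments.
Unset Strict Implicit.
Unset Printing Implicit Defensive.

Import Order.TTheory GRing.Theory Num.Theory.
Import numFieldNormedType.Exports.

Local Open Scope classical_set_scope.
Local Open Scope ring_scope.
Local Open Scope complex_scope.
Local Open Scope quotient_scope.

(* In the whole file a point of the extended complex plane is an element of
   option R[i], with None standing for the point at infinity. *)

Local Notation "x %:F" := (FracField.tofrac x).

Lemma frac_reprE (D : idomainType) (g : {fraction D}) :
  g * (\d_(repr g))%:F = (\n_(repr g))%:F.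
Proof.
rewrite -{1}[g]reprK; move: (repr g) => x.
unlock FracField.tofrac; rewrite !piE; apply/eqP; rewrite piE /=.
rewrite /FracField.equivf /FracField.mulf !numden_Ratio;
  rewrite ?mulf_neq0 ?oner_neq0 ?denom_ratioP //.
by rewrite !mulr1 mulrC.
Qed.

Lemma frac_simpl (D : idomainType) (g : {fraction D}) (n d q : D) :
  d != 0 -> q != 0 -> g * (d * q)%:F = (n * q)%:F -> g = n%:F / d%:F.
Proof.
rewrite -!(tofrac_eq0 d) -(tofrac_eq0 q) !tofracM => d0 q0 gE.
by apply: (mulIf d0); rewrite divfK //; apply: (mulIf q0); rewrite -mulrA.
Qed.

Section Fractions.
Variable F : fieldType.
Implicit Type g : {fraction {poly F}}.

(* Reduced numerator and denominator: g = fnum g / fden g with coprime fnum g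
   and fden g (unique up to a common nonzero constant, which is irrelevant
   for degrees, roots and values). *)
Definition fnum g : {poly F} :=
  let x := repr g in \n_x %/ gcdp \n_x \d_x.
Definition fden g : {poly F} :=
  let x := repr g in \d_x %/ gcdp \n_x \d_x.

Definition cstf (c : F) : {fraction {poly F}} := c%:P%:F.

Lemma fden_neq0 g : fden g != 0.
Proof. by rewrite /fden dvdp_div_eq0 ?dvdp_gcdr // denom_ratioP. Qed.

Lemma coprimep_fnum_fden g : coprimep (fnum g) (fden g).
Proof.
by apply: coprimep_div_gcd; rewrite denom_ratioP orbT.
Qed.

Lemma fnum_fdenE g : g = (fnum g)%:F / (fden g)%:F.
Proof.
apply: (@frac_simpl _ _ _ _ (gcdp \n_(repr g) \d_(repr g))).
- exact: fden_neq0.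
- by rewrite gcdp_eq0 negb_and denom_ratioP orbT.
- by rewrite !divpK ?dvdp_gcdl ?dvdp_gcdr // frac_reprE.
Qed.

(* The fraction g(1/lambda). *)
Definition recip g : {fraction {poly F}} :=
  (map_poly cstf (fnum g)).[('X%:F)^-1] / (map_poly cstf (fden g)).[('X%:F)^-1].

Definition mcmillan_degree g : nat := maxn (size (fden g)).-1 (size (fnum g)).-1.

(* C (lambda E - A)^-1 B (l0 - lambda) + D, computed in the field of rational
   functions; for l0 = infinity the factor (l0 - lambda) is dropped. *)
Definition centred_tf n (A : 'M[F]_n) (B : 'cV[F]_n) (C : 'rV[F]_n) (D : F)
    (E : 'M[F]_n) (l0 : option F) : {fraction {poly F}} :=
  (map_mx cstf C *m invmx ('X%:F *: map_mx cstf E - map_mx cstf A)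
     *m map_mx cstf B) 0 0
  * (if l0 is Some z then cstf z - 'X%:F else 1) + cstf D.

Definition pencil_det n (M N : 'M[F]_n) : {poly F} :=
  \det (map_mx polyC M - 'X *: map_mx polyC N).

End Fractions.

Section JordanForm.
Variable F : fieldType.

Definition jordan_block (k : nat) (theta : F) : 'M[F]_k :=
  \matrix_(i, j) (theta *+ (i == j) + (i.+1 == j :> nat)%:R).

Definition jord (q : nat) (theta : 'I_q -> F) (k : 'I_q -> nat) :
    'M[F]_(\sum_i k i) :=
  \mxdiag_(i < q) jordan_block (k i) (theta i).

End JordanForm.

Section Moments.
Variable K : numFieldType.
Implicit Type f : K -> K.

(* z tends to infinity when |z| tends to +oo, so for K = R[i] in every
   direction of the plane, unlike the library's pinfty_nbhs. *)
Definition infty_nbhs : set_system K :=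
  fun P => exists M : K, M \is Num.real /\ forall z, M < `|z| -> P z.

(* The derivative is the analytic one; at infinity, the limit of f^(i)(z). *)
Definition fun_moment f (i : nat) (mu : option K) : K :=
  (-1) ^+ i / i`!%:R *
  (if mu is Some z then derive1n i f z else lim (derive1n i f @ infty_nbhs)).

End Moments.

Section Transfer.
Variable R : realType.
Implicit Types (G : {fraction {poly R}}) (mu : option R[i]).

Definition cpoly (p : {poly R}) : {poly R[i]} := map_poly (real_complex R) p.
Definition cmx m n (M : 'M[R]_(m, n)) : 'M[R[i]]_(m, n) :=
  map_mx (real_complex R) M.
Definition cfrac G : {fraction {poly R[i]}} :=
  (cpoly (fnum G))%:F / (cpoly (fden G))%:F.

(* Meaningful only where z is not a pole. *)
Definition feval G (z : R[i]) : R[i] :=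
  (cpoly (fnum G)).[z] / (cpoly (fden G)).[z].

Definition pole G mu : bool :=
  if mu is Some z then root (cpoly (fden G)) z else root (fden (recip G)) 0.

Definition moment G (i : nat) mu : R[i] := fun_moment (feval G) i mu.

(* Only meant for regular square pencils, i.e. pencil_det M N != 0. *)
Definition gen_eigenvalue n (M N : 'M[R]_n) mu : bool :=
  if mu is Some z then root (cpoly (pencil_det M N)) z else \det N == 0.

Definition centred_realisation n (A : 'M[R]_n) (B : 'cV[R]_n) (C : 'rV[R]_n)
    (D : R) (E : 'M[R]_n) (l0 : option R[i]) G : Prop :=
  pencil_det A E != 0 /\
  cfrac G = centred_tf (cmx A) (cmx B) (cmx C) D%:C (cmx E) l0.

Definition minimal_centred_realisation n (A : 'M[R]_n) (B : 'cV[R]_n)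
    (C : 'rV[R]_n) (D : R) (E : 'M[R]_n) (l0 : option R[i]) G : Prop :=
  centred_realisation A B C D E l0 G /\
  forall n' (A' : 'M[R]_n') (B' : 'cV[R]_n') (C' : 'rV[R]_n') (D' : R)
    (E' : 'M[R]_n') (l0' : option R[i]),
    centred_realisation A' B' C' D' E' l0' G -> (n <= n')%N.

Definition mobius (l0 : R) mu : option R[i] :=
  if mu is Some z then (if z == l0%:C then None else Some (z - l0%:C)^-1)
  else Some 0.

(* The value of mobius as a complex number; junk value 0 at l0. *)
Definition mobius_fin (l0 : R) mu : R[i] := odflt 0 (mobius l0 mu).

Definition observable nu (L : 'rV[R]_nu) (S : 'M[R]_nu) : bool :=
  \rank (\matrix_(i < nu, j < nu) ((S^T ^+ j) *m L^T) i 0) == nu.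

End Transfer.

(* Main.v *)
Require Import Defs.
From mathcomp Require Import all_boot all_order all_algebra.
From mathcomp Require Import perm complex.
From mathcomp Require Import all_classical all_reals.
From mathcomp Require Import topology normedtype derive.
From mathcomp Require Import ring.

(* With M = A - l0 E, F = S - G L and y = X - l0, the two transfer functions are
   rational functions of the pencils P = M - y E and Q = 1 - y F. The Sylvester
   equation gives P Pi = M Pi Q + y (B - M Pi G) L, and then the matrix
   determinant lemma gives
     y C P^-1 B - y C Pi Q^-1 G = y C P^-1 (B - M Pi G) det (1 - y S) / det Q.
   The factor det (1 - y S) = prod_i (1 - y f(mu_i))^(n_i) vanishes to order n_i
   at a finite mu_i, and drops its degree if some mu_i is infinite, whence the
   moments agree. The poles p_k come from
     det (f(p_k) - F) = det D_k * (1 + L D_k^-1 G) = 0. *)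

Import Order.TTheory GRing.Theory Num.Theory.
Import numFieldNormedType.Exports.

Local Open Scope classical_set_scope.
Local Open Scope ring_scope.
Local Open Scope complex_scope.

(** * Derivatives of rational functions *)

Section RationalFunctions.
Context {K : numFieldType}.
Implicit Types (a b c d p : {poly K}) (x z : K).

Lemma is_derive_horner p x : is_derive x (1 : K) (horner p) p^`().[x].
Proof.
elim/poly_ind: p => [|p c ih].
  rewrite deriv0 horner0; have -> : horner (0 : {poly K}) = cst 0.
    by apply/funext => y; rewrite horner0.
  exact: is_derive_cst.
have -> : horner (p * 'X + c%:P) = horner p * id + cst c.
  by apply/funext => y; rewrite !hornerE.
apply: is_derive_eq.
rewrite !poly.derivE addr0 !hornerE [_ *: 1]mulr1; congr (_ + _).
exact: mulrC.
Qed.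

Lemma continuous_horner_num p : continuous (horner p).
Proof.
move=> x; apply/differentiable_continuous/derivable1_diffP.
by have [] := is_derive_horner p x.
Qed.

(* The numerator of the j-th derivative of a / b over b ^+ j.+1. *)
Fixpoint derivn_num (j : nat) a b : {poly K} :=
  if j is j'.+1 then
    (derivn_num j' a b)^`() * b - (derivn_num j' a b * b^`()) *+ j'.+1
  else a.

(** Used with [u] the current numerator, [v] the value of [b], [w = v ^+ j] and [k = j.+1]. The left
    side is what the product rule yields, the right side the next numerator over [v ^+ j.+2]. *)
Lemma quotient_rule_pow (u u' v v' w : K) (k : nat) : v != 0 -> w != 0 ->
  u * - (w * v) ^- 2 * (v' * w *+ k) + (w * v)^-1 * u' =
  (u' * v - u * v' *+ k) / (w * v * v).
Proof.
move=> v0 w0; rewrite -(mulr_natr (v' * w)) -(mulr_natr (u * v')).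
by field; rewrite v0 w0.
Qed.

Lemma derive1n_ratio (j : nat) a b z : b.[z] != 0 ->
  derive1n j (fun x => a.[x] / b.[x]) z = (derivn_num j a b).[z] / b.[z] ^+ j.+1.
Proof.
elim: j z => [|j ih] z bz; first by rewrite expr1.
rewrite derive1nS derive1E.
pose g : K -> K := horner (derivn_num j a b) * (fun y => (horner (b ^+ j.+1) y)^-1).
have bjz : (b ^+ j.+1).[z] != 0 by rewrite horner_exp expf_neq0.
(* The induction hypothesis holds only off the zeros of [b]; by continuity this covers a
   neighbourhood of [z], which determines the derivative there. *)
rewrite (@near_eq_derive _ _ _ _ g).
  have db := is_derive_horner (b ^+ j.+1) z.
  have dv : is_derive z (1 : K) (fun y => (horner (b ^+ j.+1) y)^-1)
     (- (b ^+ j.+1).[z] ^- 2 *: (b ^+ j.+1)^`().[z]).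
    case: db => db <-; apply: DeriveDef; first exact: derivableV.
    exact: deriveV.
  have dn := is_derive_horner (derivn_num j a b) z.
  rewrite derive_val deriv_exp /= -![_ *: _]/(_ * _) !(hornerE, hornerMn, horner_exp) /=.
  move: bz; set v := b.[z] => bz.
  have vjn0 : v ^+ j != 0 by rewrite expf_neq0.
  have -> : v ^+ j.+2 = v ^+ j * v * v by rewrite !exprSr.
  by rewrite [v ^+ j.+1]exprSr quotient_rule_pow.
have : \forall y \near z, b.[y] != 0.
  exact: (cvgr_neq0 _ (continuous_horner_num b z) bz).
apply: filterS => y by0; rewrite ih // /g /=.
by rewrite -horner_exp.
Qed.

Lemma derivn_numB (j : nat) a1 a2 b :
  derivn_num j (a1 - a2) b = derivn_num j a1 b - derivn_num j a2 b.
Proof.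
elim: j => //= j ->.
by rewrite derivB !mulrBl mulrnBl !opprB addrACA [X in _ + X]addrC [RHS]addrACA.
Qed.

(** Each differentiation costs at most one order of vanishing at [x]. *)
Lemma dvdp_derivn_num (j m : nat) x a b :
  ('X - x%:P) ^+ (j + m) %| a -> ('X - x%:P) ^+ m %| derivn_num j a b.
Proof.
elim: j m => [|j ih] m //= ja.
have /dvdpP[q ->] : ('X - x%:P) ^+ m.+1 %| derivn_num j a b.
  by apply: ih; rewrite addnS.
rewrite derivM deriv_exp derivXsubC mul1r /= exprS.
set y := 'X - x%:P; rewrite -mulr_natl -[(_ * b^`()) *+ _]mulr_natl.
apply/dvdpP; exists ((q^`() * y + q * m.+1%:R) * b - j.+1%:R * q * y * b^`()).
by ring.
Qed.

(** A derivative of positive order of a fraction bounded at infinity tends to 0 there, so its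
    numerator has smaller degree than [b ^+ j.+1]. The term [(j == 0)] allows equal degrees for the
    fraction itself. *)
Lemma size_derivn_num (j : nat) a b : (size a <= size b)%N ->
  (size (derivn_num j a b) <= j.+1 * (size b).-1 + (j == 0))%N.
Proof.
move=> ab; have [b0|b0] := eqVneq b 0.
  have a0 : a = 0 by apply/eqP; rewrite -size_poly_eq0 -leqn0 -(size_poly0 K) -b0.
  rewrite b0 a0; suff -> : derivn_num j 0 0 = 0 :> {poly K} by rewrite size_poly0.
  by elim: j => //= j ->; rewrite deriv0 !mul0r mul0rn subr0.
have sb : size b = (size b).-1.+1 by rewrite prednK // size_poly_gt0.
set m := (size b).-1 in sb *.
have size_der (q : {poly K}) s : (size q <= s)%N -> (size q^`() <= s.-1)%N.
  move=> qs; apply/leq_sizeP => i si; rewrite coef_deriv nth_default ?mul0rn //.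
  by apply: leq_trans qs _; case: (s) si.
have sM (p q : {poly K}) s t : (size p <= s)%N -> (size q <= t)%N ->
    (size (p * q)%R <= (s + t).-1)%N.
  by move=> ps qt; apply: leq_trans (size_polyMleq _ _) _; rewrite -!subn1 leq_sub2r ?leq_add.
elim: j => [|j ih]; first by rewrite mul1n addn1 -sb.
rewrite /=.
set s := (_ + _)%N in ih; have sm : (s <= (j.+1 * m).+1)%N.
  by rewrite /s -[leqRHS]addn1 leq_add2l leq_b1.
rewrite addn0 (leq_trans (size_polyD _ _)) // size_polyN geq_max.
have -> : (j.+2 * m = j.+1 * m + m)%N by rewrite [in LHS]mulSn addnC.
apply/andP; split.
  apply: leq_trans (sM _ _ _ _ (size_der _ _ ih) (eq_leq sb)) _.
  by rewrite addnS /= leq_add2r -ltnS; case: (s) sm.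
rewrite -mulr_natr -polyC_natr mulrC mul_polyC.
apply: leq_trans (size_scale_leq _ _) _.
apply: leq_trans (sM _ _ _ _ ih (size_der _ _ (eq_leq sb))) _.
have : (s + m <= (j.+1 * m + m).+1)%N by rewrite -addSn leq_add2r.
by rewrite /=; case: (s + m)%N.
Qed.

(** Extending a fraction by [d] does not change its derivatives, while their denominators gain
    [d ^+ j.+1]. This brings two fractions to a common denominator. *)
Lemma derivn_numM (j : nat) a b d :
  derivn_num j (a * d) (b * d) = derivn_num j a b * d ^+ j.+1.
Proof.
elim: j => [|j ih] /=; first by rewrite expr1.
rewrite {}ih; set n := derivn_num j a b.
rewrite !derivM deriv_exp /= [d ^+ j.+2]exprS [d ^+ j.+1]exprS.
rewrite -[n * _ *+ _]mulr_natl -[_ * (b^`() * d + _) *+ _]mulr_natl.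
rewrite -[_ * _ ^+ j *+ _]mulr_natl.
by ring.
Qed.

End RationalFunctions.

(** * Behaviour at infinity *)

Section PolynomialCoefficients.

(** The degree bounds [m] and [n] need not be attained, so both sides may vanish; a drop of degree
    at infinity is detected this way. *)
Lemma coef_mul_top {F : nzSemiRingType} m n (p q : {poly F}) :
  (size p <= m.+1)%N -> (size q <= n.+1)%N -> (p * q)`_(m + n) = p`_m * q`_n.
Proof.
move=> pm qn; rewrite coefM.
have mm : (m < (m + n).+1)%N by rewrite ltnS leq_addr.
rewrite (bigD1 (Ordinal mm)) //= addKn big1 ?addr0 // => i.
rewrite -val_eqE /= neq_ltn => /orP[im|mi].
  rewrite [q`__]nth_default ?mulr0 //; apply: leq_trans qn _.
  by rewrite ltn_subRL ltn_add2r.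
by rewrite nth_default ?mul0r // (leq_trans pm).
Qed.

(** The reversed polynomial X^m p(1/X), for [p] of degree at most [m]. *)
Definition revp {F : nzSemiRingType} (m : nat) (p : {poly F}) : {poly F} :=
  \poly_(i < m.+1) p`_(m - i).

Lemma horner0_revp {F : nzSemiRingType} m (p : {poly F}) : (revp m p).[0] = p`_m.
Proof. by rewrite horner_coef0 coef_poly subn0. Qed.

(** The morphism [phi] lets one statement serve for values in the field and for substitution of 1/X
    in the field of rational functions. *)
Lemma map_horner_revp {F L : fieldType} (phi : {rmorphism F -> L}) (m : nat)
    (p : {poly F}) (x : L) : x != 0 -> (size p <= m.+1)%N ->
  (map_poly phi p).[x] = x ^+ m * (map_poly phi (revp m p)).[x^-1].
Proof.
move=> x0 pm.
rewrite !(@horner_coef_wide _ m.+1) ?size_map_poly ?size_poly //.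
rewrite mulr_sumr (reindex_inj rev_ord_inj) /=; apply: eq_bigr => i _.
have im : (i <= m)%N by rewrite -ltnS.
rewrite !coef_map coef_poly ltn_ord subSS.
have -> : x ^+ m = x ^+ (m - i) * x ^+ i by rewrite -exprD subnK.
by rewrite mulrCA exprVn mulfK ?expf_neq0.
Qed.

End PolynomialCoefficients.

Section Infinity.
Context {K : numFieldType}.
Implicit Types (a b c d p : {poly K}) (x z : K).

(** The order of [K] is only partial, so radii are compared through their norms; a real [M]
    satisfies M <= |M|. *)
Global Instance infty_nbhs_filter : ProperFilter (@infty_nbhs K).
Proof.
split; first by move=> [M [Mr /(_ (`|M| + 1))]]; apply;
  rewrite ger0_norm ?addr_ge0 // ltr_pwDr // real_ler_norm.
split.
- by exists 0; split; rewrite ?rpred0.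
- move=> P Q [M [Mr MP]] [N [Nr NQ]]; exists (`|M| + `|N|).
  split=> [|z Mz]; first by rewrite rpredD ?normr_real.
  split; [apply: MP|apply: NQ]; apply: le_lt_trans Mz.
    by rewrite (le_trans (real_ler_norm Mr)) // lerDl.
  by rewrite (le_trans (real_ler_norm Nr)) // lerDr.
- by move=> P Q PQ [M [Mr MP]]; exists M; split=> // z /MP /PQ.
Qed.

Lemma infty_nbhs_neq0 : \forall z \near @infty_nbhs K, z != 0.
Proof. by exists 0; split; rewrite ?rpred0 // => z; rewrite normr_gt0. Qed.

Lemma cvg_inv_infty : (fun z : K => z^-1) @ @infty_nbhs K --> (0 : K).
Proof.
apply/cvgr0Pnorm_lt => e e0; exists e^-1; split; first by rewrite gtr0_real ?invr_gt0.
by move=> z ez; rewrite normfV invf_plt // posrE // (lt_trans _ ez) // invr_gt0.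
Qed.

Lemma cvg_revp_infty m p :
  (fun z : K => (revp m p).[z^-1]) @ @infty_nbhs K --> p`_m.
Proof.
rewrite -horner0_revp.
by apply: (cvg_comp _ _ cvg_inv_infty); exact: continuous_horner_num.
Qed.

Lemma horner_revp m p z : z != 0 -> (size p <= m.+1)%N ->
  p.[z] = z ^+ m * (revp m p).[z^-1].
Proof.
by move=> z0 pm; have := map_horner_revp idfun m p z z0 pm; rewrite !map_poly_id.
Qed.

Lemma near_infty_horner_neq0 p : p != 0 ->
  \forall z \near @infty_nbhs K, p.[z] != 0.
Proof.
move=> p0; have lc : p`_(size p).-1 != 0 by rewrite -lead_coefE lead_coef_eq0.
have rev0 : \forall z \near @infty_nbhs K, (revp (size p).-1 p).[z^-1] != 0.
  exact: (cvgr_neq0 _ (cvg_revp_infty (size p).-1 p) lc).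
apply: (filterS2 _ _ infty_nbhs_neq0 rev0) => z z0 rz.
by rewrite (horner_revp (size p).-1) ?leqSpred // mulf_neq0 ?expf_neq0.
Qed.

(** Dividing both polynomials by z^m leaves reversed polynomials at 1/z, which are continuous at
    0. *)
Lemma cvg_ratio_infty m a b :
    (size a <= m.+1)%N -> (size b <= m.+1)%N -> b`_m != 0 ->
  (fun z : K => a.[z] / b.[z]) @ @infty_nbhs K --> a`_m / b`_m.
Proof.
move=> am bm bm0.
have h : (fun z : K => (revp m a).[z^-1] / (revp m b).[z^-1]) @ @infty_nbhs K
    --> a`_m / b`_m.
  by apply: cvgM; [|apply: cvgV => //]; exact: cvg_revp_infty.
apply: cvg_trans h; apply: near_eq_cvg.
move: infty_nbhs_neq0; apply: filterS => z z0.
by rewrite (horner_revp m a) // (horner_revp m b) // -mulf_div divff ?expf_neq0 ?mul1r.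
Qed.

(** For positive [j] the bound of [size_derivn_num] makes the coefficient at the degree of the
    denominator zero. *)
Lemma lim_derive1n_ratio_infty (j : nat) a b : b != 0 ->
  (size a <= size b)%N ->
  lim (derive1n j (fun z => a.[z] / b.[z]) @ @infty_nbhs K) =
  if j is 0 then a`_(size b).-1 / lead_coef b else 0.
Proof.
move=> b0 ab; set m := (size b).-1.
have sb : size b = m.+1 by rewrite prednK // size_poly_gt0.
have bj : (size (b ^+ j.+1) = (j.+1 * m).+1)%N.
  by rewrite mulnC -size_exp prednK // size_poly_gt0 expf_neq0.
have lc : (b ^+ j.+1)`_(j.+1 * m) = lead_coef b ^+ j.+1.
  by rewrite -lead_coef_exp lead_coefE bj /=.
have lc0 : (b ^+ j.+1)`_(j.+1 * m) != 0 by rewrite lc expf_neq0 ?lead_coef_eq0.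
have sa := size_derivn_num j a b ab.
have h := @cvg_ratio_infty (j.+1 * m) (derivn_num j a b) (b ^+ j.+1) _ (eq_leq bj) lc0.
have {h} : (derive1n j (fun z => a.[z] / b.[z]) @ @infty_nbhs K) -->
    (derivn_num j a b)`_(j.+1 * m) / (b ^+ j.+1)`_(j.+1 * m).
  apply: cvg_trans (h _); last first.
    by apply: leq_trans sa _; rewrite -[leqRHS]addn1 leq_add2l leq_b1.
  apply: near_eq_cvg; move: (near_infty_horner_neq0 b b0); apply: filterS => z bz.
  by rewrite derive1n_ratio // horner_exp.
move/cvg_lim => ->; last exact: norm_hausdorff.
rewrite lc; case: j sa {bj lc lc0} => [_|j sa] /=; first by rewrite mul1n expr1.
by rewrite nth_default ?mul0r // -[leqRHS]addn0.
Qed.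

(** The difference of the fractions is (a d - c b) / (b d); it vanishes to order [m] at [z], so its
    derivatives of order below [m] vanish there. *)
Lemma fun_moment_ratio_fin (j m : nat) a b c d z :
    b.[z] != 0 -> d.[z] != 0 -> (j < m)%N ->
    ('X - z%:P) ^+ m %| a * d - c * b ->
  fun_moment (fun x => a.[x] / b.[x]) j (Some z) =
  fun_moment (fun x => c.[x] / d.[x]) j (Some z).
Proof.
move=> bz dz jm dvd; rewrite /fun_moment !derive1n_ratio //; congr (_ * _).
(* Since j < m, at least one factor X - z survives [j] differentiations. *)
have /dvdpP[q dq] : ('X - z%:P) ^+ 1 %| derivn_num j (a * d - c * b) (b * d).
  by apply: dvdp_derivn_num; rewrite addn1; apply: dvdp_trans dvd; exact: dvdp_exp2l.
have : (derivn_num j (a * d - c * b) (b * d)).[z] = 0.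
  by rewrite dq expr1 hornerM hornerXsubC subrr mulr0.
rewrite derivn_numB derivn_numM [b * d]mulrC derivn_numM !hornerE => /subr0_eq e.
by apply/eqP; rewrite eqr_div ?expf_neq0 // e.
Qed.

(** At infinity the moments of positive order of proper fractions are all 0, so multiplicity plays
    no part: a single vanishing top coefficient equates the limits. *)
Lemma fun_moment_ratio_infty (j : nat) a b c d :
    b != 0 -> d != 0 -> (size a <= size b)%N -> (size c <= size d)%N ->
    (a * d - c * b)`_((size b).-1 + (size d).-1) = 0 ->
  fun_moment (fun x => a.[x] / b.[x]) j None =
  fun_moment (fun x => c.[x] / d.[x]) j None.
Proof.
move=> b0 d0 ab cd e0; rewrite /fun_moment !lim_derive1n_ratio_infty //.
case: j => // ; congr (_ * _); apply/eqP; rewrite eqr_div ?lead_coef_eq0 //.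
rewrite !lead_coefE -coef_mul_top ?(leq_trans ab) ?(leq_trans cd) ?leqSpred //.
rewrite -coef_mul_top ?(leq_trans ab) ?(leq_trans cd) ?leqSpred //.
by rewrite [in X in _ == X]addnC -subr_eq0 -coefB e0.
Qed.

End Infinity.

(** * Determinants of pencils *)

Local Notation "x %:F" := (FracField.tofrac x).

Section DeterminantLemmas.

(* Factor [[Q, u], [v, 1]] in the two possible orders. *)
Lemma det_sub_rank1 {F : fieldType} {n : nat} (Q : 'M[F]_n) (u : 'cV[F]_n) (v : 'rV[F]_n) :
  Q \in unitmx -> \det (Q - u *m v) = \det Q * (1 - (v *m invmx Q *m u) 0 0).
Proof.
move=> Qu.
have e1 : block_mx Q u v (1%:M : 'M_1) =
    block_mx 1%:M u 0 1%:M *m block_mx (Q - u *m v) 0 v 1%:M.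
  by rewrite mulmx_block !mul1mx !mulmx1 !mul0mx subrK !add0r.
have e2 : block_mx Q u v (1%:M : 'M_1) =
    block_mx Q 0 v 1%:M *m block_mx 1%:M (invmx Q *m u) 0 (1%:M - v *m invmx Q *m u).
  rewrite mulmx_block !mul1mx !mulmx1 !mul0mx !addr0 mulKVmx //.
  by rewrite mulmxA addrC subrK.
have := congr1 determinant e1; rewrite {}e2 !det_mulmx !det_ublock !det_lblock !det1.
by rewrite !mul1r !mulr1 det_mx11 !mxE eqxx => ->.
Qed.

Lemma det_castmx {T : comNzRingType} {m n : nat} (e : m = n) (A : 'M[T]_m) :
  \det (castmx (e, e) A) = \det A.
Proof. by case: _ / e; rewrite castmx_id. Qed.

Lemma det_mxdiag {T : comNzRingType} {q : nat} (k : 'I_q -> nat)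
    (B : forall i, 'M[T]_(k i)) :
  \det (\mxdiag_(i < q) B i) = \prod_i \det (B i).
Proof.
(* The size of an empty block diagonal is an empty sum rather than a literal 0, hence the detour
   through an equation. *)
have det0 m (A : 'M[T]_m) : m = 0%N -> \det A = 1.
  by move=> m0; rewrite m0 in A *; exact: det_mx00.
elim: q k B => [|q ih] k B; first by rewrite det0 !big_ord0.
by rewrite mxdiag_recl det_castmx det_ublock ih big_ord_recl.
Qed.

(** The form b - a phi(J) covers both a pencil over polynomials, with [phi] the constants, and a
    scalar shift over the field, with [phi] the identity. *)
Lemma det_affine_jordan_block {F : fieldType} {T : comNzRingType}
    (phi : {rmorphism F -> T}) (a b : T) (k : nat) (theta : F) :
  \det (b%:M - a *: map_mx phi (jordan_block k theta)) = (b - a * phi theta) ^+ k.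
Proof.
(* Jordan blocks are upper triangular, whereas [det_trig] expects lower triangular matrices. *)
rewrite -det_tr det_trig.
  rewrite (eq_bigr (fun=> b - a * phi theta)) ?prodr_const ?card_ord // => i _.
  by rewrite !mxE eqxx mulr1n (gtn_eqF (ltnSn i)) mulr0n addr0.
apply/is_trig_mxP => i j ij; rewrite !mxE -val_eqE /= (gtn_eqF ij) mulr0n.
have -> : (j.+1 == i) = false by rewrite gtn_eqF // ltnS ltnW.
by rewrite !mulr0n addr0 rmorph0 mulr0 subr0.
Qed.

Lemma det_affine_jord {F : fieldType} {T : comNzRingType}
    (phi : {rmorphism F -> T}) (a b : T) (q : nat) (theta : 'I_q -> F) (k : 'I_q -> nat) :
  \det (b%:M - a *: map_mx phi (jord theta k)) = \prod_i (b - a * phi (theta i)) ^+ k i.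
Proof.
rewrite /jord.
have -> : b%:M - a *: map_mx phi (\mxdiag_(i < q) jordan_block (k i) (theta i)) =
    \mxdiag_(i < q) (b%:M - a *: map_mx phi (jordan_block (k i) (theta i))).
  rewrite mxdiagB mxdiagZ; congr (_ - _); apply/matrixP => s t; rewrite !mxE.
  case: eqP => [e|_]; last by rewrite !mxE rmorph0 mulr0.
  by move: e (tagnat.sig2 t) => <- j; rewrite !conform_mx_id !mxE.
by rewrite det_mxdiag; apply: eq_bigr => i _; exact: det_affine_jordan_block.
Qed.

(** Similarity is used as P S = J P, carried to [T]; the nonzero factor [phi (\det P)] is then
    cancelled in the domain [T]. *)
Lemma det_affine_similar {F : fieldType} {T : idomainType}
    (phi : {rmorphism F -> T}) (a b : T) (n : nat) (S J : 'M[F]_n) :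
  similar_in unitmx S J ->
  \det (b%:M - a *: map_mx phi S) = \det (b%:M - a *: map_mx phi J).
Proof.
move=> [P Pu /(similarP Pu) e].
have d0 : phi (\det P) != 0 by rewrite fmorph_eq0 -unitfE -unitmxE.
apply: (mulfI d0); rewrite [RHS]mulrC -det_map_mx -!det_mulmx; congr (\det _).
rewrite mulmxBr mulmxBl -scalemxAr -scalemxAl -!map_mxM e.
by rewrite mul_mx_scalar mul_scalar_mx.
Qed.

Lemma det_affine_similar_jord {F : fieldType} {T : idomainType}
    (phi : {rmorphism F -> T}) (a b : T) (n q : nat) (S : 'M[F]_n)
    (theta : 'I_q -> F) (k : 'I_q -> nat) (e : (\sum_i k i)%N = n) :
  similar_in unitmx S (castmx (e, e) (jord theta k)) ->
  \det (b%:M - a *: map_mx phi S) = \prod_i (b - a * phi (theta i)) ^+ k i.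
Proof.
move=> /(det_affine_similar phi a b _ _ _) ->; case: _ / e.
by rewrite castmx_id det_affine_jord.
Qed.

End DeterminantLemmas.

(** * Degree and values of a pencil determinant *)

Section Pencils.
Context {F : fieldType}.

Definition pencil {n : nat} (M N : 'M[F]_n) : 'M[{poly F}]_n :=
  map_mx polyC M - 'X *: map_mx polyC N.

Lemma size_prod_le2 (I : Type) (r : seq I) (f : I -> {poly F}) :
  (forall i, (size (f i) <= 2)%N) ->
  (size (\prod_(i <- r) f i)%R <= (size r).+1)%N /\
  (\prod_(i <- r) f i)`_(size r) = \prod_(i <- r) (f i)`_1.
Proof.
move=> f2; elim: r => [|i r [ih1 ih2]]; first by rewrite !big_nil size_poly1 coef1.
rewrite !big_cons; split.
  apply: leq_trans (size_polyMleq _ _) _.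
  by have := leq_add (f2 i) ih1; rewrite addSn; case: (_ + _)%N.
by rewrite -[size (_ :: _)]add1n coef_mul_top // ih2.
Qed.

(** In the Leibniz expansion each term is a product of [n] affine entries. Infinity is thus a
    generalised eigenvalue exactly when the degree drops below [n]. *)
Lemma pencil_det_top n (M N : 'M[F]_n) :
  (size (pencil_det M N) <= n.+1)%N /\ (pencil_det M N)`_n = \det (- N).
Proof.
have e2 i j : (size (pencil M N i j) <= 2)%N.
  rewrite !mxE mulrC mul_polyC (leq_trans (size_polyD _ _)) // geq_max.
  rewrite (leq_trans (size_polyC_leq1 _)) // size_polyN.
  by rewrite (leq_trans (size_scale_leq _ _)) ?size_polyX.
have e1 i j : (pencil M N i j)`_1 = (- N) i j.
  by rewrite !mxE coefB coefC coefMC coefX mul1r sub0r.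
rewrite /pencil_det -/(pencil M N) /determinant; split.
  apply: (leq_trans (size_sum _ _ _)); apply/bigmax_leqP => s _.
  rewrite -signr_odd; case: (odd _); rewrite ?mulN1r ?mul1r ?size_polyN;
    have [h _] := size_prod_le2 _ (index_enum 'I_n) (fun i => pencil M N i (s i)) (fun i => e2 i _);
    by move: h; rewrite [index_enum _]unlock -enumT size_enum_ord.
rewrite coef_sum; apply: eq_bigr => s _.
rewrite -[in LHS](rmorph_sign (@polyC F)) coefCM; congr (_ * _).
have [_ h] := size_prod_le2 _ (index_enum 'I_n) (fun i => pencil M N i (s i)) (fun i => e2 i _).
rewrite [X in _`_X](_ : n = size (index_enum 'I_n)); last first.
  by rewrite [index_enum _]unlock -enumT size_enum_ord.
by rewrite h; apply: eq_bigr => i _; rewrite e1.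
Qed.

(** A cofactor is, up to sign, the determinant of a pencil of size n - 1. *)
Lemma size_pencil_adj n (M N : 'M[F]_n) i j : (size ((\adj (pencil M N)) i j) <= n)%N.
Proof.
rewrite mxE /cofactor.
have -> : row' j (col' i (pencil M N)) = pencil (row' j (col' i M)) (row' j (col' i N)).
  by apply/matrixP => k l; rewrite !mxE.
have [h _] := pencil_det_top _ (row' j (col' i M)) (row' j (col' i N)).
have n0 : (0 < n)%N := leq_ltn_trans (leq0n i) (ltn_ord i).
rewrite -signr_odd; case: (odd _); rewrite ?mulN1r ?mul1r ?size_polyN;
  by rewrite (leq_trans h) // prednK.
Qed.

Lemma horner_pencil_det n (M N : 'M[F]_n) z : (pencil_det M N).[z] = \det (M - z *: N).
Proof.
rewrite -horner_evalE -det_map_mx; congr (\det _); apply/matrixP => i j.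
by rewrite !mxE /= /horner_eval !hornerE.
Qed.

Lemma map_pencil_det {F' : fieldType} (f : {rmorphism F -> F'}) n (M N : 'M[F]_n) :
  pencil_det (map_mx f M) (map_mx f N) = map_poly f (pencil_det M N).
Proof.
rewrite /pencil_det -det_map_mx; congr (\det _); apply/matrixP => i j.
by rewrite !mxE rmorphB rmorphM /= !map_polyC map_polyX.
Qed.

End Pencils.

(** * The error of the reduced model *)

(* Here M = A - l0 E and y = lambda - l0. *)
Lemma sylvester_transfer_difference {K : fieldType} {n nu : nat} (y : K)
    (M E : 'M[K]_n) (B : 'cV[K]_n) (C : 'rV[K]_n) (S : 'M[K]_nu)
    (L : 'rV[K]_nu) (G : 'cV[K]_nu) (Pi : 'M[K]_(n, nu)) :
  let P := M - y *: E in let Q := 1%:M - y *: (S - G *m L) in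
  P \in unitmx -> Q \in unitmx -> E *m Pi + B *m L = M *m Pi *m S ->
  y * (C *m invmx P *m B) 0 0 - y * (C *m Pi *m invmx Q *m G) 0 0 =
  y * (C *m invmx P *m (B - M *m Pi *m G)) 0 0 * (\det (1%:M - y *: S) / \det Q).
Proof.
move=> P Q Pu Qu eq; set W := B - _.
(* A rank-one update of [Q]: the quotient of determinants in the goal becomes 1 - t, with [t] as
   below. *)
have TE : 1%:M - y *: S = Q - (y *: G) *m L.
  by rewrite /Q scalerBr -scalemxAl opprD opprK addrA addrK.
have Q0 : \det Q != 0 by rewrite -unitfE -unitmxE.
rewrite TE det_sub_rank1 // [_ / \det Q]mulrAC divff // mul1r.
(* [Pi] intertwines the two pencils up to a rank-one defect; the Sylvester equation enters here. *)
have PPi : P *m Pi = M *m Pi *m Q + (y *: W) *m L.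
  rewrite /P /Q /W mulmxBl mulmxBr mulmx1 -addrA; congr (_ + _).
  have EPi : E *m Pi = M *m Pi *m S - B *m L by rewrite -eq addrK.
  rewrite -!scalemxAl -scalemxAr EPi -!scalerN -scalerDr; congr (_ *: _).
  rewrite mulmxBr !mulmxBl !mulmxA; move: (_ *m S) (_ *m G *m L) (B *m L) => a b c.
  by rewrite !opprB [RHS]addrC addrA subrK.
set t := (L *m invmx Q *m (y *: G)) 0 0.
have tE : L *m invmx Q *m (y *: G) = t%:M by rewrite [LHS]mx11_scalar.
have key : C *m invmx P *m B - C *m Pi *m invmx Q *m G = (1 - t) *: (C *m invmx P *m W).
  (* The intertwining relation is applied to Q^-1 G, where its defect becomes the scalar [t] times
     [W]. *)
  have PPiG : P *m Pi *m invmx Q *m G = M *m Pi *m G + t *: W.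
    rewrite PPi !mulmxDl mulmxK //; congr (_ + _).
    by rewrite -[t *: W]mul_mx_scalar -tE -!scalemxAl -!scalemxAr !mulmxA.
  have -> : C *m Pi *m invmx Q *m G = C *m invmx P *m (M *m Pi *m G + t *: W).
    by rewrite -PPiG !mulmxA mulmxKV.
  by rewrite -mulmxBr opprD addrA -/W scalemxAr scalerBl scale1r.
rewrite -mulrBr -mulrA; congr (_ * _).
have := congr1 (fun X : 'M_1 => X 0 0) key; rewrite !mxE => ->.
by rewrite mulrC.
Qed.

(** Clears the denominators [p] and [q] of the error formula; the common feedthrough [d] cancels.
    With plain variables, [field] never meets the determinants. *)
Lemma cross_multiply_difference {K : fieldType} (y d u v w t p q : K) :
  p != 0 -> q != 0 -> y * (w / p) - y * (v / q) = y * (u / p) * (t / q) ->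
  (y * w + d * p) * q - (y * v + d * q) * p = y * u * t.
Proof.
move=> p0 q0 e.
have -> : y * u * t = y * (u / p) * (t / q) * (p * q) by field; rewrite p0 q0.
by rewrite -e; field; rewrite p0 q0.
Qed.

(** * Centred transfer functions as quotients of polynomials *)

Section CentredTransferFunctions.
Context {F : fieldType}.
Implicit Type D : F.

(** By Cramer's rule, the numerator of C (A - X E)^-1 B over [pencil_det A E]. *)
Definition adj_form {n : nat} (A : 'M[F]_n) (B : 'cV[F]_n) (C : 'rV[F]_n) (E : 'M[F]_n) :
    {poly F} :=
  (map_mx polyC C *m \adj (pencil A E) *m map_mx polyC B) 0 0.

(** The sign changes from X E - A to A - X E and from l0 - X to X - l0 cancel each other. *)
Definition centred_num {n : nat} (A : 'M[F]_n) (B : 'cV[F]_n) (C : 'rV[F]_n) D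
    (E : 'M[F]_n) (l0 : F) : {poly F} :=
  ('X - l0%:P) * adj_form A B C E + D%:P * pencil_det A E.

(** The adjugate has degree at most n - 1, and the centring factor adds one. *)
Lemma size_XsubC_adj_form n (A : 'M[F]_n) B C (E : 'M[F]_n) (l0 : F) :
  (size (('X - l0%:P) * adj_form A B C E)%R <= n.+1)%N.
Proof.
suff h : (size (adj_form A B C E) <= n)%N.
  by apply: leq_trans (size_polyMleq _ _) _; rewrite size_XsubC /= ltnS.
rewrite /adj_form mxE (leq_trans (size_sum _ _ _)) //; apply/bigmax_leqP => j _.
rewrite !mxE mulrC mul_polyC (leq_trans (size_scale_leq _ _)) //.
rewrite (leq_trans (size_sum _ _ _)) //; apply/bigmax_leqP => k _.
rewrite mxE mul_polyC (leq_trans (size_scale_leq _ _)) //.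
exact: size_pencil_adj.
Qed.

Lemma size_centred_num n (A : 'M[F]_n) B C D (E : 'M[F]_n) (l0 : F) :
  (size (centred_num A B C D E l0) <= n.+1)%N.
Proof.
have [hd _] := pencil_det_top _ A E.
rewrite (leq_trans (size_polyD _ _)) // geq_max size_XsubC_adj_form /=.
by rewrite mul_polyC (leq_trans (size_scale_leq _ _)).
Qed.

Definition fracmx {m n : nat} (M : 'M[F]_(m, n)) : 'M[{fraction {poly F}}]_(m, n) :=
  map_mx (@FracField.tofrac {poly F}) (map_mx polyC M).

Lemma fracmx_pencil_unit n (A E : 'M[F]_n) : pencil_det A E != 0 ->
  map_mx (@FracField.tofrac {poly F}) (pencil A E) \in unitmx.
Proof. by rewrite unitmxE det_map_mx unitfE tofrac_eq0. Qed.

Lemma adj_formE n (A : 'M[F]_n) B C (E : 'M[F]_n) : pencil_det A E != 0 ->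
  (fracmx C *m invmx (map_mx (@FracField.tofrac {poly F}) (pencil A E)) *m fracmx B) 0 0 =
  (adj_form A B C E)%:F / (pencil_det A E)%:F.
Proof.
move=> d0; rewrite /invmx fracmx_pencil_unit // det_map_mx -map_mx_adj.
rewrite -scalemxAr -scalemxAl mxE -!map_mxM mxE mulrC; congr (_ / _).
Qed.

Lemma centred_tf_pencil n (A : 'M[F]_n) B C D (E : 'M[F]_n) (l0 : F) : pencil_det A E != 0 ->
  centred_tf A B C D E (Some l0) = ('X - l0%:P)%:F *
   (fracmx C *m invmx (map_mx (@FracField.tofrac {poly F}) (pencil A E)) *m fracmx B) 0 0
   + D%:P%:F.
Proof.
move=> d0; rewrite /centred_tf /cstf.
have PE : 'X%:F *: map_mx (fun c : F => c%:P%:F) E - map_mx (fun c : F => c%:P%:F) A =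
   - map_mx (@FracField.tofrac {poly F}) (pencil A E).
  by apply/matrixP => i j; rewrite !mxE tofracB tofracM opprB.
rewrite PE; set P := map_mx _ (pencil _ _).
have Pu : P \in unitmx by exact: fracmx_pencil_unit.
have -> : invmx (- P) = - invmx P.
  have e1 : - P *m - invmx P = 1%:M by rewrite mulNmx mulmxN opprK mulmxV.
  have [NPu _] := mulmx1_unit e1.
  by rewrite -[LHS]mulmx1 -e1 mulKmx.
have mapE m k (M : 'M[F]_(m, k)) : map_mx (fun c : F => c%:P%:F) M = fracmx M.
  by apply/matrixP => i j; rewrite !mxE.
rewrite !mapE mulmxN mulNmx mxE tofracB; congr (_ + _).
by rewrite mulrC -opprB mulrNN.
Qed.

Lemma centred_tfE n (A : 'M[F]_n) B C D (E : 'M[F]_n) (l0 : F) : pencil_det A E != 0 ->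
  centred_tf A B C D E (Some l0) =
  (centred_num A B C D E l0)%:F / (pencil_det A E)%:F.
Proof.
move=> d0; rewrite centred_tf_pencil // adj_formE //.
by rewrite /centred_num [in RHS]tofracD !tofracM mulrDl mulfK ?tofrac_eq0 // mulrA.
Qed.

Lemma tofrac_eq_div (a b c d : {poly F}) : b != 0 -> d != 0 ->
  a%:F / b%:F = c%:F / d%:F -> a * d = c * b.
Proof.
move=> b0 d0 /eqP; rewrite eqr_div ?tofrac_eq0 // -!tofracM tofrac_eq.
by move/eqP.
Qed.

(** The shape 1 + l0 S of the state matrix makes the pencil a function of X - l0, equal to the
    identity at l0. *)
Lemma centred_pencilE nu (l0 : F) (S : 'M[F]_nu) :
  pencil (1%:M + l0 *: S) S = 1%:M - ('X - l0%:P) *: map_mx polyC S.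
Proof.
apply/matrixP => i j; rewrite !mxE polyCD polyCM -polyCMn mulrBl opprB.
by rewrite -addrA.
Qed.

(** Up to a nonzero factor this is the characteristic polynomial of [S] at the Möbius image of
    [z]. *)
Lemma centred_pencil_det_horner nu (l0 z : F) (S : 'M[F]_nu) : z != l0 ->
  (pencil_det (1%:M + l0 *: S) S).[z] = (z - l0) ^+ nu * \det ((z - l0)^-1%:M - S).
Proof.
rewrite -subr_eq0 => zl0; rewrite horner_pencil_det -detZ; congr (\det _).
by rewrite scalerBr scale_scalar_mx divff // scalerBl opprB -addrA.
Qed.

Lemma centred_pencil_det_jord nu q (l0 : F) (S : 'M[F]_nu) (theta : 'I_q -> F)
    (k : 'I_q -> nat) (e : (\sum_i k i)%N = nu) :
  similar_in unitmx S (castmx (e, e) (jord theta k)) ->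
  pencil_det (1%:M + l0 *: S) S = \prod_i (1 - ('X - l0%:P) * (theta i)%:P) ^+ k i.
Proof.
rewrite /pencil_det -/(pencil _ _) centred_pencilE => sim.
by rewrite (det_affine_similar_jord (@polyC F) _ _ _ _ _ _ _ _ sim).
Qed.

Lemma det_scalar_sub_similar_jord nu q (x : F) (S : 'M[F]_nu) (theta : 'I_q -> F)
    (k : 'I_q -> nat) (e : (\sum_i k i)%N = nu) :
  similar_in unitmx S (castmx (e, e) (jord theta k)) ->
  \det (x%:M - S) = \prod_i (x - theta i) ^+ k i.
Proof.
move=> /(det_affine_similar_jord (idfun : {rmorphism F -> F}) 1 x) h.
move: h; rewrite scale1r map_mx_id // => ->.
by apply: eq_bigr => i _; rewrite mul1r.
Qed.

Lemma det_opp_similar_jord nu q (S : 'M[F]_nu) (theta : 'I_q -> F)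
    (k : 'I_q -> nat) (e : (\sum_i k i)%N = nu) :
  similar_in unitmx S (castmx (e, e) (jord theta k)) ->
  \det (- S) = \prod_i (- theta i) ^+ k i.
Proof.
move=> /(det_scalar_sub_similar_jord _ _ 0); rewrite raddf0 sub0r => ->.
by apply: eq_bigr => i _; rewrite sub0r.
Qed.

(** The error formula over the field of rational functions, at y = X - l0, with denominators
    cleared. The last factor, det (1 - y S), carries all the interpolation conditions. *)
Lemma centred_num_difference n nu (l0 D : F) (A E : 'M[F]_n) (B : 'cV[F]_n) (C : 'rV[F]_n)
    (S : 'M[F]_nu) (L : 'rV[F]_nu) (G : 'cV[F]_nu) (Pi : 'M[F]_(n, nu)) :
  let M := A - l0 *: E in let H := S - G *m L in
  let Am := 1%:M + l0 *: H in
  pencil_det A E != 0 -> pencil_det Am H != 0 ->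
  E *m Pi + B *m L = M *m Pi *m S ->
  centred_num A B C D E l0 * pencil_det Am H
    - centred_num Am G (C *m Pi) D H l0 * pencil_det A E =
  ('X - l0%:P) * adj_form A (B - M *m Pi *m G) C E * pencil_det (1%:M + l0 *: S) S.
Proof.
move=> M H Am d0 e0 syl.
have fM m k l (X : 'M[F]_(m, k)) (Y : 'M[F]_(k, l)) : fracmx (X *m Y) = fracmx X *m fracmx Y.
  by rewrite /fracmx !map_mxM.
have fD m k (X Y : 'M[F]_(m, k)) : fracmx (X + Y) = fracmx X + fracmx Y.
  by rewrite /fracmx !map_mxD.
have fB m k (X Y : 'M[F]_(m, k)) : fracmx (X - Y) = fracmx X - fracmx Y.
  by rewrite /fracmx !map_mxB.
pose y := ('X - l0%:P)%:F.
have PE : map_mx (@FracField.tofrac {poly F}) (pencil A E) = fracmx M - y *: fracmx E.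
  apply/matrixP => i j; rewrite !mxE /y -!tofracM -!tofracB; congr (_%:F).
  by rewrite polyCB polyCM mulrBl opprB addrA subrK.
have QE : map_mx (@FracField.tofrac {poly F}) (pencil Am H) =
    1%:M - y *: (fracmx S - fracmx G *m fracmx L).
  by rewrite centred_pencilE map_mxB map_mx1 map_mxZ -/(fracmx H) fB fM.
have TE : (pencil_det (1%:M + l0 *: S) S)%:F = \det (1%:M - y *: fracmx S).
  by rewrite -det_map_mx -/(pencil _ _) centred_pencilE map_mxB map_mx1 map_mxZ.
have Pu := fracmx_pencil_unit _ A E d0; have Qu := fracmx_pencil_unit _ Am H e0.
have fsyl : fracmx E *m fracmx Pi + fracmx B *m fracmx L = fracmx M *m fracmx Pi *m fracmx S.
  by rewrite -!fM -fD syl.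
rewrite PE in Pu; rewrite QE in Qu.
have := sylvester_transfer_difference y _ _ _ (fracmx C) _ _ _ _ Pu Qu fsyl.
rewrite -PE -QE -!fM -fB -TE !adj_formE // det_map_mx -/(pencil_det _ _).
move=> key; apply/eqP; rewrite -tofrac_eq; apply/eqP.
have p0 : (pencil_det A E)%:F != 0 by rewrite tofrac_eq0.
have q0 : (pencil_det Am H)%:F != 0 by rewrite tofrac_eq0.
(* Polynomials and determinants are replaced by variables, leaving a field identity. *)
move: key; rewrite /y /centred_num; move: ('X - l0%:P) => Y.
rewrite tofracB !tofracM !tofracD !tofracM; move: Y%:F => {Y PE QE TE Pu Qu fsyl}y0.
move: p0 q0; set p := (pencil_det A E)%:F; set q := (pencil_det Am H)%:F.
move: (adj_form _ _ _ _)%:F (adj_form _ _ _ _)%:F (adj_form _ _ _ _)%:F => u v w.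
move: (pencil_det _ _)%:F => t p0 q0 key.
have {}key : y0 * (w / p) - y0 * (v / q) = y0 * (u / p) * (t / q) := key.
move: (D%:P)%:F p q p0 q0 key => d p q p0 q0 key.
exact: (cross_multiply_difference y0 d u v w t p q p0 q0 key).
Qed.

End CentredTransferFunctions.

(** * Comparing a reduced fraction with another representation of it *)

Section ReducedFractions.
Context {F : fieldType}.
Implicit Types (a b c d p q s t : {poly F}) (g : {fraction {poly F}}).

(** By Gauss's lemma the reduced denominator [b] divides every other denominator [p]. *)
Lemma coprimep_denom_neq0 a b p s z : coprimep a b -> a * p = s * b ->
  p.[z] != 0 -> b.[z] != 0.
Proof.
move=> cop e; apply: contra_neq => bz.
have /dvdpP[q ->] : b %| p.
  by rewrite -(Gauss_dvdpr _ (_ : coprimep b a)) 1?coprimep_sym // e dvdp_mull.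
by rewrite hornerM bz mulr0.
Qed.

(** Properness depends only on the fraction, and s / p is proper because [p] has full degree [n]. *)
Lemma size_num_le_denom n a b p s : a * p = s * b -> b != 0 ->
  p`_n != 0 -> (size p <= n.+1)%N -> (size s <= n.+1)%N -> (size a <= size b)%N.
Proof.
move=> e b0 pn szp szs; have [->|a0] := eqVneq a 0; first by rewrite size_poly0.
have p0 : p != 0 by apply: contra_neq pn => ->; rewrite coef0.
have sp : size p = n.+1.
  by apply/eqP; rewrite eqn_leq szp ltnNge; apply: contra pn => /leq_sizeP/(_ n) ->.
have := size_polyMleq s b; rewrite -e size_mul // sp addnS /= => h.
have : (size a + n <= n + size b)%N.
  apply: leq_trans h _.
  have : (size s + size b <= (n + size b).+1)%N by rewrite -addSn leq_add2r.
  by case: (size s + size b)%N.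
by rewrite addnC leq_add2l.
Qed.

Lemma cross_difference a b c d p q s t : a * p = s * b -> c * q = t * d ->
  (a * d - c * b) * (p * q) = (s * q - t * p) * (b * d).
Proof.
move=> e1 e2; rewrite !mulrBl; congr (_ - _).
  by rewrite mulrACA e1; ring.
by rewrite [p * q]mulrC mulrACA e2; ring.
Qed.

(** The change of representation multiplies by p q, which is coprime to X - z. *)
Lemma dvdp_cross_difference m z a b c d p q s t : a * p = s * b -> c * q = t * d ->
  p.[z] != 0 -> q.[z] != 0 -> ('X - z%:P) ^+ m %| s * q - t * p ->
  ('X - z%:P) ^+ m %| a * d - c * b.
Proof.
move=> e1 e2 pz qz dv.
have cop : coprimep (('X - z%:P) ^+ m) (p * q).
  by rewrite coprimep_expl // coprimep_sym coprimep_XsubC rootM negb_or !rootE pz.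
by rewrite -(Gauss_dvdpl _ cop) (cross_difference _ _ _ _ _ _ _ _ e1 e2) dvdp_mulr.
Qed.

(** The counterpart at infinity: in [cross_difference] the top coefficients are compared, and those
    of [p] and [q] are nonzero. *)
Lemma coef_cross_difference n k a b c d p q s t : a * p = s * b -> c * q = t * d ->
  b != 0 -> d != 0 ->
  p`_n != 0 -> (size p <= n.+1)%N -> (size s <= n.+1)%N ->
  q`_k != 0 -> (size q <= k.+1)%N -> (size t <= k.+1)%N ->
  (s * q - t * p)`_(n + k) = 0 ->
  (a * d - c * b)`_((size b).-1 + (size d).-1) = 0.
Proof.
move=> e1 e2 b0 d0 pn szp szs qk szq szt top.
have ab := size_num_le_denom n _ _ _ _ e1 b0 pn szp szs.
have cd := size_num_le_denom k _ _ _ _ e2 d0 qk szq szt.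
have sM (u v : {poly F}) i j : (size u <= i.+1)%N -> (size v <= j.+1)%N -> (size (u * v)%R <= (i + j).+1)%N.
  move=> ui vj; apply: leq_trans (size_polyMleq _ _) _.
  by have := leq_add ui vj; rewrite addSn addnS; case: (_ + _)%N.
have sB (u v : {poly F}) i : (size u <= i)%N -> (size v <= i)%N -> (size (u - v)%R <= i)%N.
  by move=> ui vi; rewrite (leq_trans (size_polyD _ _)) // size_polyN geq_max ui.
have bm := leqSpred (size b); have dm := leqSpred (size d).
have am := leq_trans ab bm; have cm := leq_trans cd dm.
have := congr1 (fun u : {poly F} => u`_((size b).-1 + (size d).-1 + (n + k)))
  (cross_difference _ _ _ _ _ _ _ _ e1 e2).
have s1 : (size (a * d - c * b)%R <= ((size b).-1 + (size d).-1).+1)%N.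
  by apply: sB; [|rewrite addnC]; exact: sM.
have s2 : (size (s * q - t * p)%R <= (n + k).+1)%N.
  by apply: sB; [|rewrite addnC]; exact: sM.
rewrite /= coef_mul_top ?sM // [(p * q)`_ _]coef_mul_top // [(_ + (n + k))%N in RHS]addnC.
rewrite coef_mul_top ?sM // top mul0r => /eqP.
by rewrite !mulf_eq0 (negbTE pn) (negbTE qk) !orbF => /eqP.
Qed.

Lemma horner_cstf p : (map_poly (@cstf F) p).[('X)%:F] = p%:F.
Proof.
rewrite -[@cstf F]/((@FracField.tofrac {poly F} : {rmorphism _ -> _}) \o polyC).
by rewrite map_poly_comp horner_map -/(p \Po 'X) comp_polyXr.
Qed.

(** With m = deg (fden g), g(1/X) is a quotient of reversed polynomials whose denominator takes the
    leading coefficient of [fden g] at 0. *)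
Lemma recip_pole0 g : (size (fnum g) <= size (fden g))%N -> ~~ root (fden (recip g)) 0.
Proof.
move=> sz; set m := (size (fden g)).-1.
have dm : (size (fden g) <= m.+1)%N by exact: leqSpred.
have nm := leq_trans sz dm.
have X0 : ('X : {poly F})%:F^-1 != 0 by rewrite invr_eq0 tofrac_eq0 polyX_eq0.
have rd0 : (revp m (fden g)).[0] != 0.
  by rewrite horner0_revp -lead_coefE lead_coef_eq0 fden_neq0.
have rdn : revp m (fden g) != 0 by apply: contra_neq rd0 => ->; rewrite horner0.
have e : recip g = (revp m (fnum g))%:F / (revp m (fden g))%:F.
  pose phi : {rmorphism F -> _} := (@FracField.tofrac {poly F}) \o polyC.
  have h p : (size p <= m.+1)%N ->
      (map_poly (@cstf F) p).[('X%:F)^-1] = ('X%:F)^-1 ^+ m * (revp m p)%:F.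
    move=> pm; rewrite -[@cstf F]/(phi : F -> _) (map_horner_revp phi m p _ X0 pm).
    by rewrite invrK -[phi : F -> _]/(@cstf F) horner_cstf.
  by rewrite /recip !h // -mulf_div divff ?expf_neq0 // mul1r.
have := fnum_fdenE (recip g); rewrite {1}e => /tofrac_eq_div.
move=> /(_ rdn (fden_neq0 _)) /esym e2.
rewrite rootE; apply: coprimep_denom_neq0 (coprimep_fnum_fden _) e2 rd0.
Qed.

End ReducedFractions.

(** * Realisations, poles and moments *)

Section Realisations.
Context {R : realType}.
Local Notation C := R[i].

Lemma cpoly_eq0 (p : {poly R}) : (cpoly p == 0) = (p == 0).
Proof. exact: map_poly_eq0. Qed.

Lemma cpoly_size (p : {poly R}) : size (cpoly p) = size p.
Proof. exact: size_map_poly. Qed.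

Lemma cpoly_coprimep (p q : {poly R}) : coprimep (cpoly p) (cpoly q) = coprimep p q.
Proof. exact: coprimep_map. Qed.

Lemma cpoly_pencil_det n (A E : 'M[R]_n) : pencil_det (cmx A) (cmx E) = cpoly (pencil_det A E).
Proof. exact: (map_pencil_det (real_complex R)). Qed.

Lemma cpoly_centred_num n (A : 'M[R]_n) B (Cv : 'rV[R]_n) D (E : 'M[R]_n) (l0 : R) :
  centred_num (cmx A) (cmx B) (cmx Cv) D%:C (cmx E) l0%:C = cpoly (centred_num A B Cv D E l0).
Proof.
rewrite /centred_num cpoly_pencil_det /cpoly rmorphD !rmorphM rmorphB /=.
rewrite map_polyX !map_polyC /=; congr (_ * _ + _).
have mapC m k (M : 'M[R]_(m, k)) : map_mx polyC (cmx M) = map_mx (map_poly (real_complex R)) (map_mx polyC M).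
  by apply/matrixP => i j; rewrite !mxE /= map_polyC.
rewrite /adj_form.
have -> : pencil (cmx A) (cmx E) = map_mx (map_poly (real_complex R)) (pencil A E).
  by rewrite /pencil !mapC map_mxB map_mxZ /= map_polyX.
by rewrite !mapC -map_mx_adj -!map_mxM mxE.
Qed.

Lemma centred_realisation_cross n (A : 'M[R]_n) B Cv D E (l0 : R) g :
  centred_realisation A B Cv D E (Some l0%:C) g ->
  cpoly (fnum g) * pencil_det (cmx A) (cmx E) =
  centred_num (cmx A) (cmx B) (cmx Cv) D%:C (cmx E) l0%:C * cpoly (fden g).
Proof.
move=> [d0]; rewrite centred_tfE ?cpoly_pencil_det ?cpoly_eq0 // => e.
by apply: tofrac_eq_div e; rewrite ?cpoly_pencil_det cpoly_eq0 ?fden_neq0.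
Qed.

(** [cfrac] goes through the reduced form of the real fraction, so the complex identity is obtained
    from the cross-multiplied real one. *)
Lemma centred_realisation_tf n (A : 'M[R]_n) B Cv D (E : 'M[R]_n) (l0 : R) :
  pencil_det A E != 0 ->
  centred_realisation A B Cv D E (Some l0%:C) (centred_tf A B Cv D E (Some l0)).
Proof.
move=> d0; split=> //.
have d0' : pencil_det (cmx A) (cmx E) != 0 by rewrite cpoly_pencil_det cpoly_eq0.
rewrite (centred_tfE _ _ _ _ _ _ _ d0') cpoly_pencil_det.
set g := centred_tf _ _ _ _ _ _.
have := fnum_fdenE g; rewrite [in LHS]/g centred_tfE // => /tofrac_eq_div.
move=> /(_ d0 (fden_neq0 _)) e; rewrite cpoly_centred_num.
have nz (p : {poly R}) : p != 0 -> (cpoly p)%:F != 0 by rewrite tofrac_eq0 cpoly_eq0.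
apply/eqP; rewrite eqr_div ?nz ?fden_neq0 // -!tofracM tofrac_eq; apply/eqP.
by rewrite /cpoly -!rmorphM /= e.
Qed.

(** Numerator of the difference of the two transfer functions over the product of their pencil
    determinants. *)
Definition realisation_gap n n' (A : 'M[R]_n) B Cv D (E : 'M[R]_n)
    (A' : 'M[R]_n') B' Cv' D' (E' : 'M[R]_n') (l0 : R) : {poly C} :=
  centred_num (cmx A) (cmx B) (cmx Cv) D%:C (cmx E) l0%:C * pencil_det (cmx A') (cmx E')
  - centred_num (cmx A') (cmx B') (cmx Cv') D'%:C (cmx E') l0%:C * pencil_det (cmx A) (cmx E).

Lemma gen_eigenvalue_finite n (A E : 'M[R]_n) (z : C) :
  gen_eigenvalue A E (Some z) = ((pencil_det (cmx A) (cmx E)).[z] == 0).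
Proof. by rewrite /= -cpoly_pencil_det rootE. Qed.

Lemma pencil_det_top_neq0 n (A E : 'M[R]_n) :
  ~~ gen_eigenvalue A E None -> (pencil_det (cmx A) (cmx E))`_n != 0.
Proof.
have [_ ->] := pencil_det_top _ (cmx A) (cmx E).
by rewrite -scaleN1r detZ mulf_eq0 expf_eq0 oppr_eq0 oner_eq0 andbF det_map_mx fmorph_eq0.
Qed.

(** At a finite point the reduced denominator divides the pencil determinant; at infinity the full
    degree of the latter makes [g] proper. *)
Lemma realisation_not_pole n (A : 'M[R]_n) B Cv D E (l0 : R) g mu :
  centred_realisation A B Cv D E (Some l0%:C) g ->
  ~~ gen_eigenvalue A E mu -> ~~ pole g mu.
Proof.
move=> re; have e := centred_realisation_cross _ _ _ _ _ _ _ _ re.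
case: mu => [z|] ge.
  rewrite gen_eigenvalue_finite in ge; rewrite /= rootE.
  by apply: coprimep_denom_neq0 e ge; rewrite cpoly_coprimep coprimep_fnum_fden.
rewrite /=; apply: recip_pole0; rewrite -cpoly_size -(cpoly_size (fden g)).
have [sz _] := pencil_det_top _ (cmx A) (cmx E).
apply: size_num_le_denom e _ (pencil_det_top_neq0 _ _ _ ge) sz (size_centred_num _ _ _ _ _ _ _).
by rewrite cpoly_eq0 fden_neq0.
Qed.

(** The gap has degree at most n + n', so a zero coefficient there is its vanishing at infinity. The
    condition passes from the realisations to the reduced fractions that define the moments. *)
Lemma realisation_moment_eq n n' (A : 'M[R]_n) B Cv D E
    (A' : 'M[R]_n') B' Cv' D' E' (l0 : R) g g' mu (j m : nat) :
  centred_realisation A B Cv D E (Some l0%:C) g ->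
  centred_realisation A' B' Cv' D' E' (Some l0%:C) g' ->
  ~~ gen_eigenvalue A E mu -> ~~ gen_eigenvalue A' E' mu -> (j < m)%N ->
  (let gap := realisation_gap _ _ A B Cv D E A' B' Cv' D' E' l0 in
   if mu is Some z then is_true (('X - z%:P) ^+ m %| gap) else gap`_(n + n') = 0) ->
  moment g j mu = moment g' j mu.
Proof.
move=> re re' ge ge' jm; rewrite /realisation_gap /=.
have e := centred_realisation_cross _ _ _ _ _ _ _ _ re.
have e' := centred_realisation_cross _ _ _ _ _ _ _ _ re'.
have d0 : cpoly (fden g) != 0 by rewrite cpoly_eq0 fden_neq0.
have d0' : cpoly (fden g') != 0 by rewrite cpoly_eq0 fden_neq0.
case: mu ge ge' => [z|] ge ge' gap.
  rewrite gen_eigenvalue_finite in ge; rewrite gen_eigenvalue_finite in ge'.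
  apply: fun_moment_ratio_fin jm _.
  - by apply: coprimep_denom_neq0 e ge; rewrite cpoly_coprimep coprimep_fnum_fden.
  - by apply: coprimep_denom_neq0 e' ge'; rewrite cpoly_coprimep coprimep_fnum_fden.
  - exact: dvdp_cross_difference e e' ge ge' gap.
have [sz _] := pencil_det_top _ (cmx A) (cmx E).
have [sz' _] := pencil_det_top _ (cmx A') (cmx E').
have t0 := pencil_det_top_neq0 _ _ _ ge; have t0' := pencil_det_top_neq0 _ _ _ ge'.
have szn := size_centred_num _ (cmx A) (cmx B) (cmx Cv) D%:C (cmx E) l0%:C.
have szn' := size_centred_num _ (cmx A') (cmx B') (cmx Cv') D'%:C (cmx E') l0%:C.
apply: fun_moment_ratio_infty => //.
- exact: size_num_le_denom e d0 t0 sz szn.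
- exact: size_num_le_denom e' d0' t0' sz' szn'.
- exact: coef_cross_difference e e' d0 d0' t0 sz szn t0' sz' szn' gap.
Qed.

Lemma mobius_finE (l0 : R) (mu : option C) : mu <> Some l0%:C ->
  mobius l0 mu = Some (mobius_fin l0 mu).
Proof. by rewrite /mobius_fin /mobius; case: mu => [z|//]; case: eqP => // ->. Qed.

(** A finite point has a nonzero inverse as image, so it cannot meet the image 0 of infinity. *)
Lemma mobius_fin_inj (l0 : R) (mu nu : option C) :
  mu <> Some l0%:C -> nu <> Some l0%:C -> mobius_fin l0 mu = mobius_fin l0 nu -> mu = nu.
Proof.
rewrite /mobius_fin /mobius.
case: mu nu => [z|] [w|] //=; do ?[case: eqP => [->|/eqP h] //]; do ?[case: eqP => [->|/eqP h'] //] => //= _ _.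
- by move/invr_inj/addIr => ->.
- by move/eqP; rewrite invr_eq0 subr_eq0 (negbTE h).
- by move/esym/eqP; rewrite invr_eq0 subr_eq0 (negbTE h).
Qed.

(** Serves twice: to read the spectral hypothesis on [G] at the points mu_i, and to place the poles
    p_k. *)
Lemma gen_eigenvalue_centred nu (l0 : R) (S : 'M[R]_nu) mu : mu <> Some l0%:C ->
  gen_eigenvalue (1%:M + l0 *: S) S mu =
  (\det ((mobius_fin l0 mu)%:M - cmx S) == 0).
Proof.
have cS : cmx (1%:M + l0 *: S) = 1%:M + l0%:C *: cmx S.
  by rewrite /cmx map_mxD map_mx1 map_mxZ.
case: mu => [z|] zl; last first.
  rewrite /mobius_fin /= raddf0 sub0r -scaleN1r detZ mulf_eq0 expf_eq0 oppr_eq0 oner_eq0 andbF.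
  by rewrite det_map_mx fmorph_eq0.
have zl' : z != l0%:C by apply/eqP => h; apply: zl; rewrite h.
rewrite gen_eigenvalue_finite cS centred_pencil_det_horner // /mobius_fin /mobius (negbTE zl') /=.
by rewrite mulf_eq0 expf_eq0 subr_eq0 (negbTE zl') andbF.
Qed.

Lemma gen_eigenvalue_scalar nu (S : 'M[R]_nu) (s : C) :
  gen_eigenvalue S 1%:M (Some s) = (\det (s%:M - cmx S) == 0).
Proof.
rewrite gen_eigenvalue_finite horner_pencil_det /cmx map_mx1 scale_scalar_mx mulr1.
by rewrite -opprB -scaleN1r detZ mulf_eq0 expf_eq0 oppr_eq0 oner_eq0 andbF.
Qed.

(* 1 - (X - l0) f(mu_i) = - f(mu_i) (X - mu_i) when mu_i is finite, and f(mu_i) = 0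
   drops the degree when mu_i is infinite. *)
Lemma centred_pencil_det_order nu q (l0 : R) (S : 'M[C]_nu) (mu : 'I_q -> option C)
    (ns : 'I_q -> nat) (e : (\sum_i ns i)%N = nu) (i : 'I_q) :
  similar_in unitmx S (castmx (e, e) (jord (fun i => mobius_fin l0 (mu i)) ns)) ->
  (forall i, mu i <> Some l0%:C) -> (0 < ns i)%N ->
  let T := pencil_det (1%:M + l0%:C *: S) S in
  if mu i is Some z then is_true (('X - z%:P) ^+ ns i %| T) else T`_nu = 0.
Proof.
move=> sim mul nsi T; case mui: (mu i) => [z|].
  rewrite /T (centred_pencil_det_jord _ _ _ _ _ _ _ sim) (bigD1 i) //=.
  apply: dvdp_mulr; apply: dvdp_exp2r.
  have zl : z - l0%:C != 0 by rewrite subr_eq0; apply/eqP => h; apply: (mul i); rewrite mui h.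
  have -> : mobius_fin l0 (mu i) = (z - l0%:C)^-1.
    by rewrite mui /mobius_fin /mobius -subr_eq0 (negbTE zl).
  apply/dvdpP; exists (- ((z - l0%:C)^-1)%:P).
  rewrite mulNr -mulrN opprB mulrC.
  have -> : 1 = (z - l0%:C)%:P * ((z - l0%:C)^-1)%:P :> {poly C} by rewrite -polyCM divff.
  by rewrite polyCB; ring.
have [_ ->] := pencil_det_top _ (1%:M + l0%:C *: S) S.
rewrite (det_opp_similar_jord _ _ _ _ _ _ sim) (bigD1 i) //= mui.
by rewrite /mobius_fin /= oppr0 expr0n (gtn_eqF nsi) mul0r.
Qed.

End Realisations.

(** * Moment matching and pole placement for the reduced model *)

Theorem mainTheorem2 (R : realType)
  (Gtf : {fraction {poly R}}) (lambda0 : R)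
  (n : nat) (A : 'M[R]_n) (B : 'cV[R]_n) (C : 'rV[R]_n) (D : R) (E : 'M[R]_n)
  (hmin : minimal_centred_realisation A B C D E (Some lambda0%:C) Gtf)
  (hn : n = mcmillan_degree Gtf)
  (hlambda0 : ~~ pole Gtf (Some lambda0%:C))
  (nu : nat) (hnu0 : (0 < nu)%N) (hnun : (nu < n)%N)
  (alpha beta : nat) (halpha : (0 < alpha)%N) (hbeta : (beta <= nu)%N)
  (ns : 'I_alpha -> nat) (hns : forall i, (0 < ns i)%N)
  (hsum : (\sum_i ns i)%N = nu)
  (mu : 'I_alpha -> option R[i]) (p : 'I_beta -> option R[i])
  (hmu_inj : injective mu) (hp_inj : injective p)
  (hmup : forall i k, mu i <> p k)
  (hmu0 : forall i, mu i <> Some lambda0%:C)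
  (hp0 : forall k, p k <> Some lambda0%:C)
  (hmuA : forall i, ~~ gen_eigenvalue A E (mu i))
  (hmoment : exists i, exists2 j, (j < ns i)%N & moment Gtf j (mu i) != 0)
  (S : 'M[R]_nu)
  (hS : similar_in unitmx (cmx S)
          (castmx (hsum, hsum)
             (jord (fun i => mobius_fin lambda0 (mu i)) ns)))
  (L : 'rV[R]_nu) (hLS : observable L S)
  (Pi : 'M[R]_(n, nu))
  (hPi : E *m Pi + B *m L = (A - lambda0 *: E) *m Pi *m S) :
  let Dk (k : 'I_beta) : 'M[R[i]]_nu :=
    (mobius_fin lambda0 (p k))%:M - cmx S in
  (forall k, Dk k \in unitmx) /\
  let Rk (k : 'I_beta) : 'M[R]_nu := map_mx (@complex.Re R) (invmx (Dk k)) in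
  let Ik (k : 'I_beta) : 'M[R]_nu := map_mx (@complex.Im R) (invmx (Dk k)) in
  forall G : 'cV[R]_nu,
  (forall i, ~~ gen_eigenvalue (S - G *m L) 1%:M (mobius lambda0 (mu i))) ->
  (forall k, col_mx (1%:M : 'M[R]_1) (0 : 'M[R]_1)
             + col_mx (L *m Rk k) (L *m Ik k) *m G
             = col_mx (0 : 'M[R]_1) (0 : 'M[R]_1)) ->
  let Am := 1%:M + lambda0 *: (S - G *m L) in
  let Bm := G in
  let Cm := C *m Pi in
  let Dm := D in
  let Em := S - G *m L in
  let Htf := centred_tf Am Bm Cm Dm Em (Some lambda0) in
  [/\ centred_realisation Am Bm Cm Dm Em (Some lambda0%:C) Htf,
      forall i j, (j < ns i)%N ->
        ~~ pole Htf (mu i) /\ moment Gtf j (mu i) = moment Htf j (mu i)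
    & forall k, gen_eigenvalue Am Em (p k)].
Proof.
move=> Dk.
have hs : forall k i, mobius_fin lambda0 (p k) <> mobius_fin lambda0 (mu i).
  by move=> k i /mobius_fin_inj h; apply: (hmup i k); rewrite h.
have detDk k : \det (Dk k) = \prod_i (mobius_fin lambda0 (p k) - mobius_fin lambda0 (mu i)) ^+ ns i.
  exact: det_scalar_sub_similar_jord hS.
have Dku k : Dk k \in unitmx.
  rewrite unitmxE unitfE detDk; apply/prodf_neq0 => i _.
  by rewrite expf_neq0 // subr_eq0; apply/eqP; exact: hs.
split; first exact: Dku.
move=> Rk Ik G hG hp Am Bm Cm Dm Em Htf.
have ge i : ~~ gen_eigenvalue Am Em (mu i).
  have := hG i; rewrite (mobius_finE _ _ (hmu0 i)) gen_eigenvalue_scalar.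
  by rewrite gen_eigenvalue_centred.
(* The pencil is the identity at lambda0, hence regular. *)
have reg : pencil_det Am Em != 0.
  apply/eqP => h; have := horner_pencil_det _ Am Em lambda0.
  by rewrite h horner0 addrK det1 => /esym/eqP; rewrite oner_eq0.
have reH : centred_realisation Am Bm Cm Dm Em (Some lambda0%:C) Htf.
  exact: centred_realisation_tf.
have [reG _] := hmin.
have cEm : cmx Em = cmx S - cmx G *m cmx L by rewrite /cmx map_mxB map_mxM.
split; first exact: reH.
  move=> i j ji.
  split; first exact: realisation_not_pole reH (ge i).
  apply: (realisation_moment_eq _ _ _ _ _ _ _ _ _ _ _ _ _ _ _ _ _ _ reG reH (hmuA i) (ge i) ji).
  have cAm : cmx Am = 1%:M + lambda0%:C *: cmx Em.
    by rewrite /cmx /Am map_mxD map_mx1 map_mxZ.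
  have syl : cmx E *m cmx Pi + cmx B *m cmx L =
      (cmx A - lambda0%:C *: cmx E) *m cmx Pi *m cmx S.
    by rewrite /cmx -map_mxZ -map_mxB -!map_mxM -map_mxD hPi.
  have regA : pencil_det (cmx A) (cmx E) != 0.
    by case: reG => d0 _; rewrite cpoly_pencil_det cpoly_eq0.
  have regm : pencil_det (cmx Am) (cmx Em) != 0 by rewrite cpoly_pencil_det cpoly_eq0.
  rewrite /realisation_gap.
  have -> : cmx Cm = cmx C *m cmx Pi by rewrite /cmx map_mxM.
  rewrite cAm cEm in regm *.
  (* The gap is now a multiple of det (1 - y S), whose order at mu_i is known from the Jordan
     form. *)
  rewrite (centred_num_difference _ _ _ _ _ _ _ _ _ _ _ _ regA regm syl).
  have := centred_pencil_det_order _ _ _ _ _ _ _ i hS hmu0 (hns i).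
  case: (mu i) => [z|] h; first exact: dvdp_mull.
  (* At infinity the degree bounds [n] and [nu] of the two factors split the coefficient at n + nu,
     and that of the second factor is 0. *)
  have [szT _] := pencil_det_top _ (1%:M + lambda0%:C *: cmx S) (cmx S).
  by rewrite coef_mul_top ?size_XsubC_adj_form //= h mulr0.
move=> k; rewrite (gen_eigenvalue_centred _ _ _ _ (hp0 k)) cEm.
(* The feedback term is a rank-one perturbation of D_k, so singularity amounts to L D_k^-1 G =
   -1. *)
have -> : (mobius_fin lambda0 (p k))%:M - (cmx S - cmx G *m cmx L) =
    Dk k - (- cmx G) *m cmx L.
  by rewrite mulNmx opprK opprB addrA addrAC.
rewrite det_sub_rank1 // mulmxN mxE opprK.
have := hp k; rewrite mul_col_mx add_col_mx => /eq_col_mx [hr hi].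
suff -> : (cmx L *m invmx (Dk k) *m cmx G) 0 0 = -1 by rewrite subrr mulr0.
have eR : (L *m Rk k *m G) 0 0 = -1.
  have := congr1 (fun X : 'M_1 => X 0 0) hr; rewrite !mxE => /eqP.
  by rewrite eqxx addrC addr_eq0 => /eqP.
have eI : (L *m Ik k *m G) 0 0 = 0.
  by have := congr1 (fun X : 'M_1 => X 0 0) hi; rewrite [LHS]mxE !mxE add0r.
(* As [L] and [G] are real, the two real constraints are the real and imaginary parts of this
   complex equation. *)
have -> : invmx (Dk k) = cmx (Rk k) + 'i%C *: cmx (Ik k).
  apply/matrixP => u v; rewrite !mxE [LHS]complexE; congr (_ + _).
rewrite mulmxDr mulmxDl -scalemxAr -scalemxAl /cmx -!map_mxM.
rewrite mxE [X in X + _]mxE [X in _ + X]mxE [X in _ + _ * X]mxE eR eI.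
by rewrite rmorph0 mulr0 addr0 rmorphN1.
Qed.
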